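(* Let $(G,g)$ be a semi-Riemannian Lie group with a semisimple subgroup $K=K_1\times\cdots\times K_n$ generating a left-invariant conformal foliation $\mathcal F$ on $G$. Let $\mathfrak g=\mathfrak k_1\oplus\cdots\oplus\mathfrak k_n\oplus\mathfrak m$ be an orthogonal decomposition of the Lie algebra $\mathfrak g$ of $G$, where $\mathfrak k_j$ is the Lie algebra of $K_j$ and $\mathfrak m$ is two-dimensional. For each $k$ let $\mathcal V_k$ be the integrable distribution generated by $\mathfrak k_k$, let $\mathcal V=\mathcal V_1\oplus\cdots\oplus\mathcal V_n$, and let $\mathcal H$ be its orthogonal complementary distribution, generated by $\mathfrak m$. Then for all $j\neq k$ we have $\mathcal V_j[\mathcal V_k,\mathcal H]=0$, i.e. the orthogonal projection onto $\mathcal V_j$ of $[E,F]$ vanishes for all $E\in\mathfrak k_k$ and $F\in\mathfrak m$.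
   Context: A semi-Riemannian Lie group $(G,g)$ is a Lie group with a left-invariant non-degenerate metric $g$ of arbitrary signature (with $\mathfrak m$ non-degenerate); its Lie algebra is identified with the left-invariant vector fields. $K$ generates the left-invariant foliation $\mathcal F$ by left translates of $K$, tangent to $\mathcal V$. With $\nabla$ the Levi-Civita connection and $\mathcal V$ also the orthogonal projection onto $\mathcal V$, $B^{\mathcal H}(E,F)=\tfrac12\mathcal V(\nabla_EF+\nabla_FE)$ for $E,F\in\mathcal H$; $\mathcal F$ is conformal if there is a vector field $V$ in $\mathcal V$ with $B^{\mathcal H}(E,F)=g(E,F)V$ for all $E,F\in\mathcal H$. *)

(* Defs.v *)
(* the Lie algebra of left-invariant vector fields of a
   semi-Riemannian Lie group, modelled as a finite-dimensional real vector
   space (vectType over a realType) with a bracket and a metric. *)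
From HB Require Import structures.
From mathcomp Require Import all_boot all_order all_algebra.
From mathcomp Require Import reals.
Set Implicit Arguments. Unset Strict Implicit. Unset Printing Implicit Defensive.
Import Order.TTheory GRing.Theory Num.Theory.
Local Open Scope ring_scope.


Section LieDefs.
Variables (R : realType) (V : vectType R).

Definition is_lie_bracket (br : V -> V -> V) : Prop :=
  [/\ (forall a x y z, br (a *: x + y) z = a *: br x z + br y z),
      (forall a x y z, br z (a *: x + y) = a *: br z x + br z y),
      (forall x, br x x = 0)
    & (forall x y z, br x (br y z) + br y (br z x) + br z (br x y) = 0)].

Definition is_metric (g : V -> V -> R) : Prop :=
  [/\ (forall a x y z, g (a *: x + y) z = a * g x z + g y z),
      (forall x y, g x y = g y x)
    & (forall x, (forall y, g x y = 0) -> x = 0)].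

(* the subspace spanned by all brackets [u, v], u in A, v in B
   (by bilinearity it is spanned by brackets of basis vectors) *)
Definition bracket_space (br : V -> V -> V) (A B : {vspace V}) : {vspace V} :=
  <<[seq br u v | u <- vbasis A, v <- vbasis B]>>%VS.

Definition subalgebra (br : V -> V -> V) (A : {vspace V}) : Prop :=
  forall x y, x \in A -> y \in A -> br x y \in A.

Definition lie_ideal (br : V -> V -> V) (A I : {vspace V}) : Prop :=
  (I <= A)%VS /\ forall x y, x \in A -> y \in I -> br x y \in I.

Definition derived (br : V -> V -> V) (r : nat) (I : {vspace V}) : {vspace V} :=
  iter r (fun D => bracket_space br D D) I.

Definition solvable_lie (br : V -> V -> V) (I : {vspace V}) : Prop :=
  exists r, derived br r I = 0%VS.

Definition semisimple_lie (br : V -> V -> V) (A : {vspace V}) : Prop :=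
  subalgebra br A /\
  forall I, lie_ideal br A I -> solvable_lie br I -> I = 0%VS.

(* Levi-Civita connection restricted to left-invariant vector fields:
   torsion free, and metric (g(Y,Z) is constant for left-invariant Y, Z). *)
Definition levi_civita (br : V -> V -> V) (g : V -> V -> R)
    (nabla : V -> V -> V) : Prop :=
  (forall X Y, nabla X Y - nabla Y X = br X Y) /\
  (forall X Y Z, g (nabla X Y) Z + g Y (nabla X Z) = 0).

(* The left-invariant foliation tangent to Vert (horizontal space Hor) is
   conformal: there is a vertical V0 with B^H(E,F) = g(E,F) V0 for all
   E, F horizontal, where B^H(E,F) is the vertical component (w.r.t. the
   direct sum Vert (+) Hor) of (nabla_E F + nabla_F E)/2. *)
Definition conformal_foliation (g : V -> V -> R) (nabla : V -> V -> V)
    (Vert Hor : {vspace V}) : Prop :=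
  exists2 V0, V0 \in Vert &
    forall E F, E \in Hor -> F \in Hor ->
      exists2 h, h \in Hor &
        2^-1 *: (nabla E F + nabla F E) = g E F *: V0 + h.

End LieDefs.

(* Main.v *)
Require Import Defs.
From HB Require Import structures.
From mathcomp Require Import all_boot all_order all_algebra.
From mathcomp Require Import spectral reals complex ring lra.
Set Implicit Arguments. Unset Strict Implicit. Unset Printing Implicit Defensive.
Import Order.TTheory GRing.Theory Num.Theory.
Local Open Scope ring_scope.

(** Conformality says that the [m]-component of [ad A], for [A] in the semisimple
    algebra [K], is a conformal endomorphism of the plane [m].  These
    endomorphisms form an abelian algebra and [A |-> (ad A)_m] is a
    representation of [K] on the quotient by [K]; since [K] is perfect it is
    trivial, so [[K, m]] lies in [K].  For [B] in [k_j], [E] in [k_l], [F] in [m]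
    the Jacobi identity gives [[B, [E, F]] = [E, [B, F]]], which lies both in
    [k_j] and in [k_l], hence vanishes: the [k_j]-component of [[E, F]] is central
    in [K], thus zero.

    Perfectness of [K] comes from the nondegeneracy of its Killing form.  If [X]
    is a derivation with complex generalized eigenspaces [L_a], acting on each
    [L_a] by the conjugate of [a] is again a derivation [D], and
    [tr (X D) = sum |a|^2 dim L_a].  For [X = ad h] with [h] in [[S, K]], [S] the
    radical of the Killing form, this trace is zero, so [h] is ad-nilpotent;
    Engel's theorem makes [[S, K]] a solvable ideal, hence zero, and [S] is
    central, hence zero. *)

(** * Algebras given by structure constants, and their derivations as matrices *)

Section StructureConstants.
Variables (F : comNzRingType) (d : nat) (c : 'I_d -> 'M[F]_d).

(* [c] encodes the bilinear product [u, v |-> v *m algmx u] on row vectors. *)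
Definition algmx (u : 'rV[F]_d) : 'M[F]_d := \sum_i u 0 i *: c i.

(** The Leibniz rule D(uv) = D(u)v + uD(v) for operators acting on rows from the right, with the
    arbitrary row [v] stripped off the left. *)
Definition mx_derivation (D : 'M[F]_d) : Prop :=
  forall u, algmx u *m D = algmx (u *m D) + D *m algmx u.

Lemma algmxD u v : algmx (u + v) = algmx u + algmx v.
Proof.
by rewrite /algmx -big_split; apply: eq_bigr => i _; rewrite mxE scalerDl.
Qed.

Lemma algmxZ a u : algmx (a *: u) = a *: algmx u.
Proof.
by rewrite /algmx scaler_sumr; apply: eq_bigr => i _; rewrite mxE scalerA.
Qed.

Lemma algmx0 : algmx 0 = 0.
Proof. by rewrite -[X in algmx X](scale0r 0) algmxZ scale0r. Qed.

Lemma algmxB u v : algmx (u - v) = algmx u - algmx v.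
Proof. by rewrite algmxD -scaleN1r algmxZ scaleN1r. Qed.

Lemma algmx_delta i : algmx (delta_mx 0 i) = c i.
Proof.
rewrite /algmx (bigD1 i) //= mxE !eqxx scale1r big1 ?addr0 // => j /negPf ji.
by rewrite mxE ji andbF scale0r.
Qed.

Lemma mx_derivation_basis D :
  (forall i, c i *m D = algmx (row i D) + D *m c i) -> mx_derivation D.
Proof.
move=> Dc u; rewrite {1 3}/algmx mulmx_suml mulmx_sumr mulmx_sum_row.
rewrite (big_morph algmx algmxD algmx0) -big_split; apply: eq_bigr => i _ /=.
by rewrite -scalemxAl Dc scalerDr algmxZ -scalemxAr.
Qed.

End StructureConstants.

(** * Chinese remainders and primary decomposition *)

Section Polynomials.
Variable F : fieldType.

(** Such a [q], evaluated at a matrix, acts on the vectors killed by the [N]-th power at [a] as the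
    scalar [f a], for all the listed [a] at once. *)
Lemma chinese_remainder_XsubC (s : seq F) (N : nat) (f : F -> F) :
  exists q : {poly F}, forall a, a \in s -> ('X - a%:P) ^+ N %| q - (f a)%:P.
Proof.
suff [q Hq] : exists q : {poly F},
    forall a, a \in undup s -> ('X - a%:P) ^+ N %| q - (f a)%:P.
  by exists q => a sa; apply: Hq; rewrite mem_undup.
elim: (undup s) (undup_uniq s) => [_|a r IH /= /andP[ar /IH[q Hq]]].
  by exists 0.
pose P := \prod_(b <- r) ('X - b%:P) ^+ N.
have coP : coprimep (('X - a%:P) ^+ N) P.
  rewrite /P big_seq; elim/big_ind: _ => [|x y hx hy|b br].
  - exact: coprimep1.
  - by rewrite coprimepMr hx.
  - rewrite coprimep_expr ?coprimep_expl // coprimep_XsubC root_XsubC.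
    by apply: contraNneq ar => <-.
have [[u v] /= uv] := Bezout_eq1_coprimepP _ _ coP.
(* By Bezout [v * P] is 1 modulo the new factor and 0 modulo the old ones, so the correction sets
   the value at [a] and leaves the others alone. *)
exists (q + ((f a)%:P - q) * (v * P)) => b; rewrite inE => /predU1P[->|br].
  have -> : q + ((f a)%:P - q) * (v * P) - (f a)%:P =
            (q - (f a)%:P) * (1 - v * P).
    by rewrite mulrBr mulr1 -(opprB q) mulNr addrAC.
  by rewrite -uv addrK mulrA dvdp_mull.
rewrite addrAC dvdp_addr ?Hq // dvdp_mull // dvdp_mull //.
by rewrite /P (big_rem b) //= dvdp_mulr.
Qed.

(* Bezout's identity splits [v] along the pairwise coprime factors. *)
Lemma generalized_eigenvector_ind d (X : 'M[F]_d.+1) (P : 'rV[F]_d.+1 -> Prop)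
    (s : seq F) (e : F -> nat) (v : 'rV[F]_d.+1) :
  uniq s -> P 0 -> (forall u w, P u -> P w -> P (u + w)) ->
  (forall a w, a \in s -> w *m horner_mx X (('X - a%:P) ^+ e a) = 0 -> P w) ->
  v *m horner_mx X (\prod_(a <- s) ('X - a%:P) ^+ e a) = 0 -> P v.
Proof.
move=> + P0 PD; elim: s v => [|a s IH] v /=.
  by move=> _ _; rewrite big_nil rmorph1 mulmx1 => ->.
move=> /andP[as_ us] Pa; rewrite big_cons; set p := _ ^+ _; set r := \prod_(_ <- _) _.
have co : coprimep p r.
  rewrite /r big_seq; elim/big_ind: _ => [|x y hx hy|b bs].
  - exact: coprimep1.
  - by rewrite coprimepMr hx.
  - rewrite coprimep_expr ?coprimep_expl // coprimep_XsubC root_XsubC.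
    by apply: contraNneq as_ => <-.
have [[u w] /= uw] := Bezout_eq1_coprimepP _ _ co.
move=> vpr.
have -> : v = v *m horner_mx X (u * p) + v *m horner_mx X (w * r).
  by rewrite -mulmxDr -rmorphD uw rmorph1 mulmx1.
apply: PD.
  apply: IH => // [b x bs xb|]; first by apply: (Pa b); rewrite ?inE ?bs ?orbT.
  rewrite -mulmxA mulmxE -rmorphM -/r /=.
  by rewrite -mulrA mulrC rmorphM /= -mulmxE mulmxA vpr mul0mx.
apply: (Pa a); first exact: mem_head.
rewrite -mulmxA mulmxE -rmorphM -/p /=.
rewrite (_ : w * r * p = p * r * w); last by rewrite mulrC [in LHS]mulrA mulrAC.
by rewrite rmorphM /= -mulmxE mulmxA vpr mul0mx.
Qed.

End Polynomials.

(** * Triangular matrices and their diagonals *)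

Section TriangularMatrices.
Variables (F : comNzRingType) (d : nat).
Implicit Types A B : 'M[F]_d.+1.

Lemma mul_trig_mx A B : is_trig_mx A -> is_trig_mx B -> is_trig_mx (A * B).
Proof.
move=> /is_trig_mxP At /is_trig_mxP Bt; apply/is_trig_mxP => i j ij.
rewrite mxE big1 // => l _; case: (ltnP i l) => il.
  by rewrite At // mul0r.
by rewrite Bt ?mulr0 // (leq_ltn_trans il).
Qed.

Lemma diag_mul_trig_mx A B i : is_trig_mx A -> is_trig_mx B ->
  (A * B) i i = A i i * B i i.
Proof.
move=> /is_trig_mxP At /is_trig_mxP Bt.
rewrite mxE (bigD1 i) //= big1 ?addr0 // => l; rewrite neq_ltn => /orP[] il.
  by rewrite Bt ?mulr0.
by rewrite At ?mul0r.
Qed.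

Lemma horner_trig_mx A (p : {poly F}) : is_trig_mx A ->
  is_trig_mx (horner_mx A p) /\ forall i, horner_mx A p i i = p.[A i i].
Proof.
move=> At; elim/poly_ind: p => [|p a [IH1 IH2]].
  by rewrite rmorph0 mx0_is_trig; split=> // i; rewrite mxE horner0.
rewrite rmorphD rmorphM /= horner_mx_X horner_mx_C; split=> [|i].
  have /is_trig_mxP tr := mul_trig_mx IH1 At; apply/is_trig_mxP => i j ij.
  by rewrite mxE tr // add0r; apply/is_trig_mxP: i j ij; apply: scalar_mx_is_trig.
by rewrite mxE diag_mul_trig_mx // IH2 mxE eqxx hornerMXaddC.
Qed.

End TriangularMatrices.

(** * Generalized eigenspaces of a derivation *)

Lemma algmx_generalized_eigenvector (F : comNzRingType) d (c : 'I_d.+1 -> 'M[F]_d.+1)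
    (X : 'M[F]_d.+1) (a b : F) (m n : nat) (u v : 'rV[F]_d.+1) :
  mx_derivation c X ->
  u *m (X - a%:M) ^+ m = 0 -> v *m (X - b%:M) ^+ n = 0 ->
  (v *m algmx c u) *m (X - (a + b)%:M) ^+ (m + n) = 0.
Proof.
(* By Leibniz, X - (a + b) acts on a product as X - a on one factor plus X - b on the other. Each
   application lowers one of the two exponents, so m + n of them kill every term. *)
move=> derX; have step x y : y *m algmx c x *m (X - (a + b)%:M) =
    y *m algmx c (x *m (X - a%:M)) + y *m (X - b%:M) *m algmx c x.
  rewrite mulmxBr -[y *m _ *m X]mulmxA derX mulmxDr mulmxA mul_mx_scalar.
  rewrite mulmxBr mul_mx_scalar algmxB algmxZ.
  rewrite mulmxBr -scalemxAr mulmxBr mul_mx_scalar mulmxBl -scalemxAl.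
  by rewrite scalerDl opprD addrACA.
elim: {m n}(m + n)%N {-2}m {-2}n (erefl (m + n)%N) u v => [|N IH] m n.
  move=> /eqP; rewrite addn_eq0 => /andP[/eqP-> /eqP->] u v.
  by rewrite expr0 mulmx1 => -> _; rewrite algmx0 mulmx0 mul0mx.
case: m => [|m] mn u v.
  by rewrite expr0 mulmx1 => -> _; rewrite algmx0 mulmx0 mul0mx.
case: n mn => [|n] mn.
  by rewrite [v *m _]mulmx1 => _ ->; rewrite !mul0mx.
move=> um vn; have [e1 e2] : (m + n.+1 = N)%N /\ (m.+1 + n = N)%N.
  by move: mn; rewrite addSn => -[]; rewrite addnS addSn.
rewrite mn exprS -mulmxE mulmxA step mulmxDl.
have h1 : u *m (X - a%:M) *m (X - a%:M) ^+ m = 0.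
  by rewrite -mulmxA mulmxE -exprS.
have h2 : v *m (X - b%:M) *m (X - b%:M) ^+ n = 0.
  by rewrite -mulmxA mulmxE -exprS.
have := IH _ _ e1 _ _ h1 vn; have := IH _ _ e2 _ _ um h2.
by rewrite e1 e2 => -> ->; rewrite addr0.
Qed.

Lemma horner_mx_generalized_eigenvector (F : fieldType) d (X : 'M[F]_d.+1)
    (q : {poly F}) a b N (w : 'rV[F]_d.+1) :
  w *m (X - a%:M) ^+ N = 0 -> ('X - a%:P) ^+ N %| q - b%:P ->
  w *m horner_mx X q = b *: w.
Proof.
move=> wX /dvdpP[r qr]; have -> : q = r * ('X - a%:P) ^+ N + b%:P.
  by rewrite -qr subrK.
rewrite rmorphD mulrC rmorphM rmorphXn rmorphB /= horner_mx_X !horner_mx_C.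
by rewrite mulmxDr -mulmxE mulmxA wX mul0mx add0r mul_mx_scalar.
Qed.

(* The derivation acts on the generalized eigenspace of [a] by the conjugate of [a];
   it is a derivation because conjugation is additive. *)
Lemma conjugate_derivation (C : numClosedFieldType) d (c : 'I_d.+1 -> 'M[C]_d.+1)
    (X : 'M[C]_d.+1) : mx_derivation c X ->
  exists2 D, mx_derivation c D & (\tr (X *m D) = 0 -> X ^+ d.+1 = 0).
Proof.
move=> derX.
have [P /unitarymx_unit Pu] := Schur X (ltn0Sn d).
rewrite /similar_to /= conjumx // => Tt; set T := P *m X *m invmx P in Tt.
have XT : X = invmx P *m T *m P by rewrite /T !mulmxA mulVmx // mul1mx mulmxKV.
clearbody T.
pose s := [seq T i i | i <- enum 'I_d.+1].
have s_size : size s = d.+1 by rewrite size_map size_enum_ord.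
have annX : horner_mx X (\prod_(a <- s) ('X - a%:P)) = 0.
  rewrite big_map big_enum /= -char_poly_trig // XT horner_mx_uconjC //.
  by rewrite Cayley_Hamilton mulmx0 mul0mx.
(* A product of eigenvectors for [a] and [b] belongs to [a + b], so [q] must also take conjugate
   values at the sums; the doubled exponent is the one that kills such a product. *)
pose r := s ++ [seq a + b | a <- s, b <- s].
have [q Hq] := chinese_remainder_XsubC r (d.+1 + d.+1) Num.conj.
exists (horner_mx X q) => [u|].
  (* Every row is a sum of generalized eigenvectors, so an additive property need only be checked on
     these; multiplicities are padded to the uniform exponent [d.+1]. *)
  have decomp (Q : 'rV[C]_d.+1 -> Prop) : Q 0 ->
      (forall u w, Q u -> Q w -> Q (u + w)) ->
      (forall a w, a \in s -> w *m (X - a%:M) ^+ d.+1 = 0 -> Q w) ->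
      forall u, Q u.
    move=> Q0 QD Qs w.
    apply: (@generalized_eigenvector_ind _ _ X Q (undup s) (fun a => count_mem a s)) => //.
    - exact: undup_uniq.
    - move=> a x; rewrite mem_undup => sa xa; apply: (Qs a) => //.
      have [N sN] : {N | (d.+1 = count_mem a s + N)%N}.
        by exists (d.+1 - count_mem a s)%N; rewrite subnKC // -s_size count_size.
      rewrite [X in _ ^+ X]sN exprD -mulmxE mulmxA; move: xa.
      rewrite rmorphXn rmorphB /= horner_mx_X horner_mx_C => ->.
      by rewrite mul0mx.
    - by rewrite prodr_undup_exp_count annX mulmx0.
  have act a (w : 'rV_d.+1) : a \in r -> w *m (X - a%:M) ^+ (d.+1 + d.+1) = 0 ->
      w *m horner_mx X q = a^* *: w.
    by move=> ra wa; apply: horner_mx_generalized_eigenvector wa (Hq _ ra).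
  have act1 a (w : 'rV_d.+1) : a \in s -> w *m (X - a%:M) ^+ d.+1 = 0 ->
      w *m horner_mx X q = a^* *: w.
    move=> sa wa; apply: act; first by rewrite mem_cat sa.
    by rewrite exprD -mulmxE mulmxA wa mul0mx.
  suff main : forall v : 'rV_d.+1, v *m (algmx c u *m horner_mx X q) =
      v *m (algmx c (u *m horner_mx X q) + horner_mx X q *m algmx c u).
    by apply/row_matrixP => i; rewrite !rowE.
  move: u; apply: (decomp) => [v|u w IHu IHw v|a u sa ua].
  - by rewrite mul0mx algmx0 mul0mx !mulmx0 addr0 mulmx0.
  - by rewrite !(mulmxDl, algmxD, mulmxDr) IHu IHw !mulmxDr addrACA.
  apply: decomp => [|v w IHv IHw|b v sb vb].
  - by rewrite !mul0mx.
  - by rewrite !mulmxDl IHv IHw.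
  rewrite mulmxA (act (a + b)); last 2 first.
  - by rewrite mem_cat; apply/orP; right; apply/allpairsP; exists (a, b).
  - exact: algmx_generalized_eigenvector.
  rewrite mulmxDr (act1 a u) // algmxZ mulmxA (act1 b v) //.
  by rewrite -scalemxAr -scalemxAl rmorphD scalerDl.
have [qTt qTd] := horner_trig_mx q Tt.
(* Trace is invariant under conjugation by [P], and the diagonal of the triangular T q(T) has
   entries z times the conjugate of z. When this sum vanishes all eigenvalues do, and
   Cayley-Hamilton gives nilpotency. *)
have -> : \tr (X *m horner_mx X q) = \sum_i `|T i i| ^+ 2.
  rewrite {1 2}XT horner_mx_uconjC // -!mulmxA mxtrace_mulC.
  rewrite -!mulmxA mulmxV // mulmx1 mulKVmx //.
  rewrite /mxtrace; apply: eq_bigr => i _; rewrite mulmxE diag_mul_trig_mx // qTd.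
  rewrite normCK; congr (_ * _).
  have Ts : T i i \in r by rewrite mem_cat (map_f (fun i => T i i)) ?mem_enum.
  have := dvdp_trans (dvdp_exp2l ('X - (T i i)%:P) (ltn0Sn _)) (Hq _ Ts).
  by rewrite expr1 dvdp_XsubCl rootE !hornerE subr_eq0 => /eqP.
move=> /eqP; rewrite psumr_eq0 => [/allP T0|i _]; last by rewrite exprn_ge0.
have T0i i : T i i = 0.
  by have := T0 i (mem_index_enum i); rewrite /= expf_eq0 normr_eq0 => /eqP.
rewrite -annX big_map big_enum /= (eq_bigr (fun=> 'X)) => [|i _].
  by rewrite prodr_const card_ord rmorphXn /= horner_mx_X.
by rewrite T0i subr0.
Qed.

(** * Real and imaginary parts of complex matrices *)

Section RealForms.
Variables (R : rcfType) (f : R[i] -> R).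
Local Notation toC := (real_complex R).
Hypothesis fD : {morph f : x y / x + y}.
Hypothesis fZ : forall a z, f (toC a * z) = a * f z.

Let f0 : f 0 = 0.
Proof. by rewrite -[X in f X](mul0r 0) -(rmorph0 toC) fZ mul0r. Qed.

Let f_sum I r (P : pred I) F : f (\sum_(i <- r | P i) F i) = \sum_(i <- r | P i) f (F i).
Proof. exact: (big_morph f fD f0). Qed.

Lemma map_mx_real_mull m n p (A : 'M[R]_(m, n)) (B : 'M[R[i]]_(n, p)) :
  map_mx f (map_mx toC A *m B) = A *m map_mx f B.
Proof.
by apply/matrixP => i j; rewrite !mxE f_sum; apply: eq_bigr => k _; rewrite !mxE fZ.
Qed.

Lemma map_mx_real_mulr m n p (A : 'M[R[i]]_(m, n)) (B : 'M[R]_(n, p)) :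
  map_mx f (A *m map_mx toC B) = map_mx f A *m B.
Proof.
apply/matrixP => i j; rewrite !mxE f_sum; apply: eq_bigr => k _.
by rewrite !mxE mulrC fZ mulrC.
Qed.

Lemma map_mx_real_algmx d (c : 'I_d -> 'M[R]_d) (u : 'rV[R[i]]_d) :
  map_mx f (algmx (fun i => map_mx toC (c i)) u) = algmx c (map_mx f u).
Proof.
apply/matrixP => i j; rewrite /algmx !mxE !summxE f_sum; apply: eq_bigr => k _.
by rewrite !mxE mulrC fZ mulrC.
Qed.

Lemma map_mx_real_derivation d (c : 'I_d -> 'M[R]_d) (D : 'M[R[i]]_d) :
  mx_derivation (fun i => map_mx toC (c i)) D -> mx_derivation c (map_mx f D).
Proof.
move=> derD; apply: mx_derivation_basis => i.
have := congr1 (map_mx f) (derD (delta_mx 0 i)).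
rewrite algmx_delta map_mx_real_mull => ->; rewrite -rowE -map_row.
rewrite -map_mx_real_algmx -map_mx_real_mulr.
by apply/matrixP => j k; rewrite !mxE fD.
Qed.

Lemma mxtrace_real d (A : 'M[R]_d) (B : 'M[R[i]]_d) :
  f (\tr (map_mx toC A *m B)) = \tr (A *m map_mx f B).
Proof.
by rewrite -map_mx_real_mull /mxtrace f_sum; apply: eq_bigr => i _; rewrite [RHS]mxE.
Qed.

End RealForms.

(** Over the complex numbers the conjugate derivation [D] decides nilpotency. Since the structure
    constants are real, its real and imaginary parts are real derivations, so both parts of tr(X D)
    vanish by assumption. *)
Lemma derivation_nilpotent (R : rcfType) d (c : 'I_d.+1 -> 'M[R]_d.+1)
    (X : 'M[R]_d.+1) : mx_derivation c X ->
  (forall D, mx_derivation c D -> \tr (X *m D) = 0) -> X ^+ d.+1 = 0.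
Proof.
move=> derX trX; pose cC i := map_mx (real_complex R) (c i).
have derXC : mx_derivation cC (map_mx (real_complex R) X).
  apply: mx_derivation_basis => i; rewrite /cC -map_row -!map_mxM /=.
  rewrite -(algmx_delta c i) derX -rowE map_mxD; congr (_ + _).
  apply/matrixP => j k; rewrite /algmx !mxE !summxE.
  by rewrite /= rmorph_sum; apply: eq_bigr => l _; rewrite !mxE rmorphM.
have [D derD nilD] := conjugate_derivation derXC.
have ReD : {morph @complex.Re R : x y / x + y} by case=> a b [].
have ImD : {morph @complex.Im R : x y / x + y} by case=> a b [].
have ReZ a z : complex.Re (real_complex R a * z) = a * complex.Re z.
  by case: z => x y /=; rewrite mul0r subr0.
have ImZ a z : complex.Im (real_complex R a * z) = a * complex.Im z.
  by case: z => x y /=; rewrite mul0r addr0.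
have : map_mx (real_complex R) X ^+ d.+1 = 0.
  apply: nilD; apply/eqP; rewrite eq_complex.
  rewrite (mxtrace_real ReD ReZ) (mxtrace_real ImD ImZ).
  by rewrite !trX ?eqxx //; apply: map_mx_real_derivation.
rewrite -rmorphXn => /matrixP X0; apply/matrixP => i j.
by have := X0 i j; rewrite !mxE => /complexI.
Qed.

(** * Lie brackets and spaces spanned by brackets *)

Section LieAlgebra.
Variables (R : realType) (V : vectType R) (br : V -> V -> V).
Hypothesis br_lie : is_lie_bracket br.

Lemma brPl a x y z : br (a *: x + y) z = a *: br x z + br y z.
Proof. by case: br_lie. Qed.

Lemma brPr a x y z : br z (a *: x + y) = a *: br z x + br z y.
Proof. by case: br_lie. Qed.

Lemma br0l z : br 0 z = 0.
Proof.
by apply: (addrI (br 0 z)); rewrite -{1}[br 0 z]scale1r -brPl scaler0 !addr0.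
Qed.

Lemma br0r z : br z 0 = 0.
Proof.
by apply: (addrI (br z 0)); rewrite -{1}[br z 0]scale1r -brPr scaler0 !addr0.
Qed.

Lemma brDl x y z : br (x + y) z = br x z + br y z.
Proof. by rewrite -{1}[x]scale1r brPl scale1r. Qed.

Lemma brDr x y z : br z (x + y) = br z x + br z y.
Proof. by rewrite -{1}[x]scale1r brPr scale1r. Qed.

Lemma brZl a x z : br (a *: x) z = a *: br x z.
Proof. by rewrite -{1}[a *: x]addr0 brPl br0l addr0. Qed.

Lemma brZr a x z : br z (a *: x) = a *: br z x.
Proof. by rewrite -{1}[a *: x]addr0 brPr br0r addr0. Qed.

Lemma br_suml I r (P : pred I) F z :
  br (\sum_(i <- r | P i) F i) z = \sum_(i <- r | P i) br (F i) z.
Proof. exact: (big_morph (br^~ z) (fun x y => brDl x y z) (br0l z)). Qed.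

Lemma br_sumr I r (P : pred I) F z :
  br z (\sum_(i <- r | P i) F i) = \sum_(i <- r | P i) br z (F i).
Proof. exact: (big_morph (br z) (fun x y => brDr x y z) (br0r z)). Qed.

Lemma br_anti x y : br x y = - br y x.
Proof.
case: br_lie => _ _ alt _; apply/eqP; rewrite -addr_eq0; apply/eqP.
by have := alt (x + y); rewrite brDl !brDr !alt add0r addr0.
Qed.

Lemma brNr x y : br x (- y) = - br x y.
Proof. by rewrite -scaleN1r brZr scaleN1r. Qed.

Lemma br_jacobi x y z : br x (br y z) = br (br x y) z + br y (br x z).
Proof.
case: br_lie => _ _ _ /(_ x y z) /eqP; rewrite -addrA addr_eq0 => /eqP ->.
by rewrite opprD addrC [br z _]br_anti opprK [br z x]br_anti brNr opprK.
Qed.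

Lemma br_iterP r x a u v :
  iter r (br x) (a *: u + v) = a *: iter r (br x) u + iter r (br x) v.
Proof. by elim: r => //= r ->; rewrite brPr. Qed.

Lemma br_iter0 r x : iter r (br x) 0 = 0.
Proof. by elim: r => //= r ->; rewrite br0r. Qed.

Lemma mem_bracket_space (A B : {vspace V}) u v :
  u \in A -> v \in B -> br u v \in bracket_space br A B.
Proof.
move=> /coord_vbasis -> /coord_vbasis ->.
rewrite br_suml memv_suml // => i _; rewrite br_sumr memv_suml // => j _.
rewrite brZl brZr !memvZ // memv_span //; apply/allpairsP.
by exists ((vbasis A)`_i, (vbasis B)`_j); split=> //=; rewrite mem_nth ?size_tuple.
Qed.

Lemma bracket_space_ind (A B : {vspace V}) (P : V -> Prop) :
  P 0 -> (forall a x y, P x -> P y -> P (a *: x + y)) ->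
  (forall u v, u \in A -> v \in B -> P (br u v)) ->
  forall x, x \in bracket_space br A B -> P x.
Proof.
move=> P0 PD Pbr x; rewrite /bracket_space; set s := (X in span X).
move=> /(@coord_span _ _ _ (in_tuple s)) ->.
elim/big_rec: _ => // i y _ Py; apply: PD => //=.
have /allpairsP[[u v] /= [uA vB ->]] : s`_i \in s by rewrite mem_nth.
by apply: Pbr; apply: vbasis_mem.
Qed.

Lemma bracket_space_sub (A B W : {vspace V}) :
  (forall u v, u \in A -> v \in B -> br u v \in W) ->
  (bracket_space br A B <= W)%VS.
Proof.
move=> H; apply/subvP; apply: bracket_space_ind => //; first exact: mem0v.
by move=> a x y xW yW; rewrite memvD ?memvZ.
Qed.

Lemma bracket_spaceS (A B A' B' : {vspace V}) : (A <= A')%VS -> (B <= B')%VS ->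
  (bracket_space br A B <= bracket_space br A' B')%VS.
Proof.
move=> /subvP AA /subvP BB; apply: bracket_space_sub => u v /AA uA /BB vB.
exact: mem_bracket_space.
Qed.

(** * Engel's theorem for a subalgebra acting nilpotently on [K] *)

Section Engel.
Variables N K : {vspace V}.
Hypotheses (N_sub : subalgebra br N) (K_sub : subalgebra br K) (NK : (N <= K)%VS).
Hypothesis N_nil : forall x, x \in N -> exists r, forall v, v \in K -> iter r (br x) v = 0.

Let action (M : {vspace V}) r W := iter r (bracket_space br M) W.

Let actionS M r (W W' : {vspace V}) : (W <= W')%VS -> (action M r W <= action M r W')%VS.
Proof. by move=> WW; elim: r => //= r IH; rewrite bracket_spaceS. Qed.

Let action_sub M r : (M <= N)%VS -> (action M r K <= K)%VS.
Proof.
move=> MN; elim: r => [|r IH] //=; apply: bracket_space_sub => u v uM vW.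
by apply: K_sub; [apply: (subvP NK); apply: (subvP MN)|apply: (subvP IH)].
Qed.

(* A vector outside [M] in the last term of the descending [M]-series of [N] not
   contained in [M] normalizes [M]. *)
Let normalizing_vector (M : {vspace V}) r : (M <= N)%VS -> ~~ (N <= M)%VS ->
  action M r K = 0%VS ->
  exists x, [/\ x \in N, x \notin M & forall y, y \in M -> br y x \in M].
Proof.
move=> MN NM Mr.
have ex : exists i, (action M i N <= M)%VS.
  by exists r; apply: subv_trans (sub0v _); rewrite -Mr actionS.
case: (ex_minnP ex) => -[|i] Mi min_i; first by rewrite Mi in NM.
have /subvPn[x xi xM] : ~~ (action M i N <= M)%VS.
  by apply/negP => /min_i; rewrite ltnn.
exists x; split=> // [|y yM].
  suff /subvP : (action M i N <= N)%VS by apply.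
  elim: (i) => //= j IH; apply: bracket_space_sub => u v uM vW.
  by apply: N_sub; [apply: (subvP MN)|apply: (subvP IH)].
by apply: (subvP Mi); apply: mem_bracket_space.
Qed.

(** As [x] normalizes [M], ad x preserves each layer of the descending [M]-series of [K]. On the
    quotient of successive layers [M] acts by zero, so only the nilpotent ad x is left. *)
Let extend_nilpotent (M : {vspace V}) r x : (M <= N)%VS -> x \in N ->
  (forall y, y \in M -> br y x \in M) ->
  action M r K = 0%VS -> exists r', action (M + <[x]>)%VS r' K = 0%VS.
Proof.
move=> MN xN xM Mr; have [s xs] := N_nil xN.
have stable i w : w \in action M i K -> br x w \in action M i K.
  elim: i w => [|i IH] /= w; first by apply: K_sub; apply: (subvP NK).
  move: w; apply: bracket_space_ind => [|a u v hu hv|m w mM wi].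
  - by rewrite br0r mem0v.
  - by rewrite brPr memvD ?memvZ.
  - rewrite br_jacobi memvD ?mem_bracket_space ?IH //.
    by rewrite br_anti rpredN xM.
have decr i : (action M i.+1 K <= action M i K)%VS.
  elim: i => [|i IH]; last exact: bracket_spaceS.
  exact: (@action_sub M 1).
(* Modulo the next layer, [t] brackets with M + <x> reduce to the [t]-th power of ad x. *)
have step (U : {vspace V}) i t : (U <= action M i K)%VS ->
    forall y, y \in action (M + <[x]>)%VS t U ->
    y \in action M i K /\
    exists2 w, w \in action M i K & y - iter t (br x) w \in action M i.+1 K.
  move=> Ui; elim: t => [|t IH] y /=.
    by move=> /(subvP Ui) yi; split=> //; exists y; rewrite ?subrr ?mem0v.
  move: y; apply: bracket_space_ind => [|a u v [ui [w wi hw]] [vi [w' wi' hw']]|].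
  - by split; [exact: mem0v|exists 0; rewrite ?br_iter0 ?br0r ?subrr mem0v].
  - split; first by rewrite memvD ?memvZ.
    exists (a *: w + w'); first by rewrite memvD ?memvZ.
    rewrite br_iterP brPr opprD addrACA -scalerBr memvD ?memvZ //.
  move=> z y /memv_addP[m mM [_ /vlineP[a ->] ->]] /IH[yi [w wi hw]].
  rewrite brDl brZl; split.
    by rewrite memvD ?memvZ ?stable // (subvP (decr i)) // mem_bracket_space.
  exists (a *: w); first by rewrite memvZ.
  have -> : iter t (br x) (a *: w) = a *: iter t (br x) w.
    by rewrite -[a *: w]addr0 br_iterP br_iter0 addr0.
  rewrite brZr -addrA -scalerBr memvD ?mem_bracket_space // memvZ //.
  by rewrite -brNr -brDr; apply: (stable i.+1).
(* There are [r] layers, and [s] brackets descend each of them. *)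
exists (r * s)%N; apply/eqP; rewrite -subv0 -Mr.
elim: r {Mr} => [|i IH]; first by rewrite mul0n.
rewrite mulSn /action iterD -!/(action _ _ _).
apply/subvP => y /(step _ _ _ IH)[_ [w wi]].
by rewrite xs ?subr0 // (subvP (action_sub i MN)).
Qed.

(** Starting from the zero subalgebra, one normalizing vector is adjoined at a time. The result is
    again a subalgebra acting nilpotently on [K], and the codimension in [N] drops. *)
Lemma engel : exists r, iter r (bracket_space br N) K = 0%VS.
Proof.
suff H n (M : {vspace V}) r : (\dim N - \dim M <= n)%N -> (M <= N)%VS ->
    subalgebra br M -> action M r K = 0%VS -> exists r', action N r' K = 0%VS.
  apply: (H _ 0%VS 1 (leqnn _)) => [||]; first exact: sub0v.
  - by move=> x y; rewrite !memv0 => /eqP -> _; rewrite br0l.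
  - apply/eqP; rewrite -subv0; apply: bracket_space_sub => u v.
    by rewrite memv0 => /eqP -> _; rewrite br0l mem0v.
elim: n M r => [|n IH] M r dimM MN M_sub Mr; case: (boolP (N <= M)%VS) => NM;
  try by exists r; have -> : N = M by apply/eqP; rewrite eqEsubv NM.
- have := dimv_leqif_sup MN => /ltn_leqif; rewrite NM.
  by move: dimM; rewrite leqn0 subn_eq0 ltnNge => ->.
have [x [xN xM Mx]] := normalizing_vector MN NM Mr.
have [r' Mr'] := extend_nilpotent MN xN Mx Mr.
apply: (IH (M + <[x]>)%VS r') => //.
- have : (\dim M < \dim (M + <[x]>))%N.
    have := dimv_leqif_sup (addvSl M <[x]>) => /ltn_leqif ->.
    apply: contra xM => /subvP; apply.
    by rewrite (subvP (addvSr _ _)) // memv_line.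
  move=> lt; rewrite -ltnS (leq_trans _ dimM) // ltn_sub2l //.
  by have := dimv_leqif_sup MN => /ltn_leqif ->.
- by rewrite subv_add MN -memvE.
move=> y z /memv_addP[u uM [_ /vlineP[a ->] ->]].
move=> /memv_addP[v vM [_ /vlineP[b ->] ->]].
apply: (subvP (addvSl _ _)); rewrite brDl !brDr !brZl !brZr.
case: br_lie => _ _ -> _; rewrite !scaler0 addr0.
have xvM : br x v \in M by rewrite br_anti rpredN Mx.
by rewrite !memvD ?memvZ ?Mx ?xvM ?M_sub.
Qed.

Lemma engel_solvable : solvable_lie br N.
Proof.
have [r Nr] := engel; exists r; apply/eqP; rewrite -subv0 -Nr.
suff /andP[] : (derived br r N <= N)%VS && (derived br r N <= action N r K)%VS by [].
elim: r {Nr} => [|r /andP[IH1 IH2]]; first by rewrite subvv.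
rewrite /= bracket_spaceS // andbT; apply: bracket_space_sub => u v.
by move=> /(subvP IH1) uN /(subvP IH1) vN; apply: N_sub.
Qed.

End Engel.

(** A central vector spans an abelian, hence solvable, ideal. *)
Lemma semisimple_center (K : {vspace V}) x : semisimple_lie br K -> x \in K ->
  (forall y, y \in K -> br y x = 0) -> x = 0.
Proof.
move=> [_ ss] xK cx; apply/eqP; rewrite -memv0 -(ss <[x]>%VS) ?memv_line //.
  split=> [|y z yK /vlineP[a ->]]; first by rewrite -memvE.
  by rewrite brZr cx // scaler0 mem0v.
exists 1; apply/eqP; rewrite -subv0; apply: bracket_space_sub => y z.
move=> /vlineP[a ->] /vlineP[b ->]; rewrite brZl brZr.
by case: br_lie => _ _ -> _; rewrite !scaler0 mem0v.
Qed.

End LieAlgebra.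

(** * The Killing form and perfectness of semisimple algebras *)

Section KillingForm.
Variables (R : realType) (V : vectType R) (br : V -> V -> V).
Hypothesis br_lie : is_lie_bracket br.
Variables (K : {vspace V}) (d : nat) (e : d.+1.-tuple V).
Hypotheses (e_basis : basis_of K e) (K_sub : subalgebra br K).

Let eK i : e`_i \in K.
Proof.
case: (ltnP i (size e)) => [ie|ie]; last by rewrite nth_default ?mem0v.
by rewrite (basis_mem e_basis) // mem_nth.
Qed.

Definition coords x : 'rV[R]_d.+1 := \row_i coord e i x.
Definition of_coords (u : 'rV[R]_d.+1) : V := \sum_i u 0 i *: e`_i.
Definition admx x : 'M[R]_d.+1 := \matrix_i coords (br x e`_i).
Definition killing x y : R := \tr (admx x *m admx y).

Lemma coordsK x : x \in K -> of_coords (coords x) = x.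
Proof.
move=> xK; rewrite [RHS](coord_basis e_basis xK).
by apply: eq_bigr => i _; rewrite mxE.
Qed.

Lemma of_coords_mem u : of_coords u \in K.
Proof. by rewrite memv_suml // => i _; rewrite memvZ. Qed.

Lemma coordsD x y : coords (x + y) = coords x + coords y.
Proof. by apply/rowP => i; rewrite !mxE linearD. Qed.

Lemma coords_sum I r (P : pred I) F :
  coords (\sum_(i <- r | P i) F i) = \sum_(i <- r | P i) coords (F i).
Proof.
by apply/rowP => i; rewrite mxE linear_sum summxE; apply: eq_bigr => j _; rewrite mxE.
Qed.

Lemma coordsZ a x : coords (a *: x) = a *: coords x.
Proof. by apply/rowP => i; rewrite !mxE linearZ. Qed.

Lemma admxP a x y : admx (a *: x + y) = a *: admx x + admx y.
Proof. by apply/matrixP => i j; rewrite !mxE (brPl br_lie) linearP. Qed.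

Lemma admx0 : admx 0 = 0.
Proof. by apply/matrixP => i j; rewrite !mxE (br0l br_lie) linear0. Qed.

Lemma mul_admx u x : u *m admx x = coords (br x (of_coords u)).
Proof.
rewrite mulmx_sum_row (br_sumr br_lie) coords_sum; apply: eq_bigr => i _.
by rewrite rowK (brZr br_lie) coordsZ.
Qed.

Lemma mul_coords_admx v x : v \in K -> coords v *m admx x = coords (br x v).
Proof. by move=> vK; rewrite mul_admx coordsK. Qed.

Lemma coords_admx_iter r x v : x \in K -> v \in K ->
  coords v *m admx x ^+ r = coords (iter r (br x) v).
Proof.
move=> xK vK; elim: r => [|r IH]; first by rewrite mulmx1.
have iK : iter r (br x) v \in K by elim: (r) => //= s IHs; apply: K_sub.
by rewrite exprSr -mulmxE mulmxA IH mul_coords_admx.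
Qed.

Lemma algmx_admx u : algmx (fun i : 'I_d.+1 => admx e`_i) u = admx (of_coords u).
Proof.
rewrite /algmx /of_coords; elim/big_rec2: _ => [|i A x _ ->]; first by rewrite admx0.
by rewrite admxP.
Qed.

(** Matrices act on rows from the right, so composition is reversed and the commutator appears in
    the opposite order. *)
Lemma admx_br x y : x \in K -> y \in K ->
  admx (br x y) = admx y *m admx x - admx x *m admx y.
Proof.
move=> xK yK; apply/row_matrixP => i; rewrite !rowE; set u := delta_mx _ _.
rewrite mulmxBr !mulmxA !mul_admx !coordsK; try exact: K_sub (of_coords_mem u).
by rewrite (br_jacobi br_lie x) coordsD addrK.
Qed.

Lemma admx_derivation x : x \in K ->
  mx_derivation (fun i : 'I_d.+1 => admx e`_i) (admx x).
Proof.
move=> xK u; rewrite !algmx_admx mul_admx coordsK; last exact: K_sub (of_coords_mem u).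
by rewrite admx_br ?of_coords_mem // subrK.
Qed.

(** Cyclicity of the trace moves the commutator onto ad y and D, and the commutator of D with ad y
    is ad(Dy). Taking D = ad z gives invariance of the Killing form; a general D serves the
    nilpotency criterion. *)
Lemma mxtrace_admx_br_derivation x y D : x \in K -> y \in K ->
  mx_derivation (fun i : 'I_d.+1 => admx e`_i) D ->
  \tr (admx (br x y) *m D) = - killing x (of_coords (coords y *m D)).
Proof.
move=> xK yK /(_ (coords y)); rewrite !algmx_admx coordsK // => derD.
rewrite admx_br // mulmxBl linearB /= -[X in _ - \tr X]mulmxA derD mulmxDr linearD /=.
rewrite -[admx y *m _ *m _]mulmxA mxtrace_mulC -mulmxA.
by rewrite opprD addrCA subrr addr0.
Qed.

Lemma killing_invariant x y z : x \in K -> y \in K -> z \in K ->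
  killing (br x y) z = killing x (br y z).
Proof.
move=> xK yK zK.
rewrite {1}/killing (mxtrace_admx_br_derivation xK yK (admx_derivation zK)).
rewrite mul_coords_admx // coordsK ?K_sub // (br_anti br_lie z).
rewrite /killing -scaleN1r -[_ *: _]addr0 admxP admx0 addr0.
by rewrite -scalemxAr linearZ /= mulN1r opprK.
Qed.

Lemma killingPl a x y z : killing (a *: x + y) z = a * killing x z + killing y z.
Proof. by rewrite /killing admxP mulmxDl linearD -scalemxAl linearZ. Qed.

Lemma killingC x y : killing x y = killing y x.
Proof. exact: mxtrace_mulC. Qed.

Lemma killing_orthogonal (W : {vspace V}) : exists T : {vspace V},
  (forall x, x \in T <-> x \in K /\ forall y, y \in W -> killing x y = 0) /\
  (\dim K <= \dim T + \dim W)%N.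
Proof.
pose f0 x : 'rV[R]_(\dim W) := \row_i killing x (vbasis W)`_i.
have lf : linear f0 by move=> a x y; apply/rowP => i; rewrite !mxE killingPl.
pose f : {linear V -> 'rV[R]_(\dim W)} :=
  HB.pack f0 (GRing.isLinear.Build R V 'rV[R]_(\dim W) _ f0 lf).
exists (K :&: lker (linfun f))%VS; split=> [x|]; last first.
  rewrite -(limg_ker_dim (linfun f) K) leq_add2l (leq_trans (dimvS (subvf _))) //.
  by rewrite dimvf /dim /= mul1n.
rewrite memv_cap memv_ker lfunE /=; split=> [/andP[xK /eqP f0x]|[xK xW]].
  split=> // y /coord_vbasis ->; rewrite killingC.
  elim/big_rec: _ => [|i z _ IH].
    by rewrite -(scale0r 0) -[X in killing X]addr0 killingPl mul0r add0r
               /killing admx0 mul0mx linear0.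
  rewrite killingPl IH addr0 killingC; have /rowP/(_ i) := f0x.
  by rewrite !mxE => ->; rewrite mulr0.
rewrite xK; apply/eqP/rowP => i; rewrite !mxE xW // vbasis_mem // mem_nth //.
by rewrite size_tuple.
Qed.

Hypothesis K_ss : semisimple_lie br K.

Lemma killing_nondegenerate x : x \in K ->
  (forall y, y \in K -> killing x y = 0) -> x = 0.
Proof.
have [S [SP _]] := killing_orthogonal K.
have SK : (S <= K)%VS by apply/subvP => y /SP[].
have S_ideal y s : y \in K -> s \in S -> br s y \in S.
  move=> yK /SP[sK s0]; apply/SP; split=> [|z zK]; first exact: K_sub.
  by rewrite killing_invariant // s0 // K_sub.
(* The trace identity applies to brackets [s, w]: it turns tr(ad [s, w] D) into a Killing value of
   [s], which is zero for [s] in the radical. *)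
pose N := bracket_space br S K.
have NK : (N <= K)%VS.
  by apply: bracket_space_sub => // u v /(subvP SK) uK vK; apply: K_sub.
have N_ideal : lie_ideal br K N.
  split=> // y z yK; move: z; apply: bracket_space_ind => [|a u v uN vN|s v sS vK].
  - by rewrite (br0r br_lie) mem0v.
  - by rewrite (brPr br_lie) memvD ?memvZ.
  - rewrite (br_jacobi br_lie) memvD ?mem_bracket_space ?K_sub //.
    by rewrite (br_anti br_lie) rpredN S_ideal.
have N_nil h : h \in N -> exists r, forall v, v \in K -> iter r (br h) v = 0.
  move=> hN; have hK := subvP NK _ hN; exists d.+1 => v vK.
  suff nil : admx h ^+ d.+1 = 0.
    have iK : iter d.+1 (br h) v \in K by elim: (d.+1) => //= s IHs; apply: K_sub.
    rewrite -(coordsK iK) -coords_admx_iter // nil mulmx0 /of_coords big1 // => i _.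
    by rewrite mxE scale0r.
  apply: derivation_nilpotent (admx_derivation hK) _ => D derD.
  move: h hN {hK}; apply: bracket_space_ind => [|a u w hu hw|s w sS wK].
  - by rewrite admx0 mul0mx linear0.
  - by rewrite admxP mulmxDl linearD -scalemxAl linearZ /= hu hw mulr0 addr0.
  - have [sK s0] := (SP s).1 sS.
    by rewrite mxtrace_admx_br_derivation // s0 ?oppr0 // of_coords_mem.
have N0 : N = 0%VS.
  case: K_ss => _; apply=> //; apply: engel_solvable N_nil => //.
  by move=> y z /(subvP NK) yK zN; case: N_ideal => _; apply.
move=> xK x0; apply: (semisimple_center br_lie K_ss xK) => y yK.
have xS : x \in S by apply/SP.
apply/eqP; rewrite (br_anti br_lie) oppr_eq0 -memv0 -N0.
exact: mem_bracket_space.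
Qed.

(** If [x] is Killing-orthogonal to [K, K], invariance makes every [x, y] orthogonal to [K], so [x]
    is central and zero. The dimension bound for orthogonals then leaves no room between [K, K] and
    [K]. *)
Lemma semisimple_perfect_basis : bracket_space br K K = K.
Proof.
have PK : (bracket_space br K K <= K)%VS by apply: bracket_space_sub.
have [T [TP dimT]] := killing_orthogonal (bracket_space br K K).
suff T0 : T = 0%VS.
  by apply/eqP; rewrite eqEdim PK /=; move: dimT; rewrite T0 dimv0.
apply/eqP; rewrite -subv0; apply/subvP => x /TP[xK x0]; rewrite memv0; apply/eqP.
apply: (semisimple_center br_lie K_ss xK) => y yK.
apply/eqP; rewrite (br_anti br_lie) oppr_eq0; apply/eqP.
apply: killing_nondegenerate => [|z zK]; first exact: K_sub.
by rewrite killing_invariant // x0 // mem_bracket_space.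
Qed.

End KillingForm.

Lemma semisimple_perfect (R : realType) (V : vectType R) (br : V -> V -> V)
    (K : {vspace V}) :
  is_lie_bracket br -> semisimple_lie br K -> bracket_space br K K = K.
Proof.
(* The zero algebra is treated apart, since the matrix argument works in positive size. *)
move=> br_lie K_ss; have K_sub := K_ss.1; case dK: (\dim K) => [|d].
  have PK : (bracket_space br K K <= K)%VS by apply: bracket_space_sub.
  by apply/eqP; rewrite eqEdim PK dK.
apply: (@semisimple_perfect_basis _ _ _ br_lie K d (tcast dK (vbasis K))) => //.
by rewrite val_tcast vbasisP.
Qed.

(** * The metric and conformal endomorphisms of a nondegenerate plane *)

Section Metric.
Variables (R : realType) (V : vectType R) (g : V -> V -> R).
Hypothesis g_metric : is_metric g.

Lemma metricC x y : g x y = g y x.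
Proof. by case: g_metric. Qed.

Lemma metricPl a x y z : g (a *: x + y) z = a * g x z + g y z.
Proof. by case: g_metric. Qed.

Lemma metric0l z : g 0 z = 0.
Proof.
apply: (addrI (g 0 z)); have := metricPl 1 0 0 z.
by rewrite scaler0 !addr0 mul1r.
Qed.

Lemma metricDl x y z : g (x + y) z = g x z + g y z.
Proof. by rewrite -{1}[x]scale1r metricPl mul1r. Qed.

Lemma metricZl a x z : g (a *: x) z = a * g x z.
Proof. by rewrite -[a *: x]addr0 metricPl metric0l addr0. Qed.

Lemma metricNl x z : g (- x) z = - g x z.
Proof. by rewrite -scaleN1r metricZl mulN1r. Qed.

Lemma metricDr x y z : g z (x + y) = g z x + g z y.
Proof. by rewrite metricC metricDl !(metricC z). Qed.

Lemma metricZr a x z : g z (a *: x) = a * g z x.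
Proof. by rewrite metricC metricZl (metricC z). Qed.

Lemma metricNr x z : g z (- x) = - g z x.
Proof. by rewrite metricC metricNl (metricC z). Qed.

Lemma metric_suml I r (P : pred I) F z :
  g (\sum_(i <- r | P i) F i) z = \sum_(i <- r | P i) g (F i) z.
Proof. exact: (big_morph (g^~ z) (fun x y => metricDl x y z) (metric0l z)). Qed.

(* The g-skew endomorphisms of a nondegenerate plane form a line, so the
   conformal ones form an abelian algebra. *)
Lemma plane_conformal_commute (m : {vspace V}) (S T : V -> V) (a b : R) :
  \dim m = 2%N ->
  (forall x, x \in m -> (forall y, y \in m -> g x y = 0) -> x = 0) ->
  (forall r x y, S (r *: x + y) = r *: S x + S y) ->
  (forall r x y, T (r *: x + y) = r *: T x + T y) ->
  (forall x, x \in m -> S x \in m) -> (forall x, x \in m -> T x \in m) ->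
  (forall x y, x \in m -> y \in m -> g (S x) y + g x (S y) = 2 * a * g x y) ->
  (forall x y, x \in m -> y \in m -> g (T x) y + g x (T y) = 2 * b * g x y) ->
  forall x, x \in m -> S (T x) = T (S x).
Proof.
move=> dm nd S_lin T_lin Sm Tm S_conf T_conf.
have [e1 [e2 [e1m e2m em]]] : exists e1 e2, [/\ e1 \in m, e2 \in m &
    forall x, x \in m -> exists x1 x2, x = x1 *: e1 + x2 *: e2].
  have be : basis_of m (tcast dm (vbasis m)) by rewrite val_tcast vbasisP.
  move: be; move: (tcast dm (vbasis m)) => e be.
  exists e`_0, e`_1; split=> [||x xm].
  - by rewrite (basis_mem be) // mem_nth // size_tuple.
  - by rewrite (basis_mem be) // mem_nth // size_tuple.
  exists (coord e ord0 x), (coord e (lift ord0 ord0) x).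
  by rewrite {1}(coord_basis be xm) !big_ord_recl big_ord0 addr0.
(* U - c is [g]-skew, so pairing it with [g] gives an alternating form on the plane, which is a
   multiple of the determinant. *)
have area (U : V -> V) c : (forall r x y, U (r *: x + y) = r *: U x + U y) ->
    (forall x y, x \in m -> y \in m -> g (U x) y + g x (U y) = 2 * c * g x y) ->
    forall x1 x2 y1 y2,
    g (U (x1 *: e1 + x2 *: e2) - c *: (x1 *: e1 + x2 *: e2)) (y1 *: e1 + y2 *: e2)
    = (x1 * y2 - x2 * y1) * (g (U e1) e2 - c * g e1 e2).
  move=> U_lin U_conf x1 x2 y1 y2.
  have U0 : U 0 = 0.
    by apply: (addrI (U 0)); have := U_lin 1 0 0; rewrite scaler0 !addr0 scale1r.
  have UZ r x : U (r *: x) = r *: U x by rewrite -[r *: x]addr0 U_lin U0 addr0.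
  have := U_conf _ _ e1m e1m; have := U_conf _ _ e1m e2m.
  have := U_conf _ _ e2m e2m.
  rewrite U_lin UZ !(metricDl, metricZl, metricNl, metricDr, metricZr, metricNr).
  rewrite (metricC e1 (U e1)) (metricC e2 (U e2)) (metricC e1 (U e2)) (metricC e2 e1).
  move=> h22 h12 h11.
  have -> : g (U e2) e1 = 2 * c * g e1 e2 - g (U e1) e2 by lra.
  have -> : g (U e1) e1 = c * g e1 e1 by lra.
  have -> : g (U e2) e2 = c * g e2 e2 by lra.
  by ring.
set wS := g (S e1) e2 - a * g e1 e2; set wT := g (T e1) e2 - b * g e1 e2.
have S0 : S 0 = 0.
  by apply: (addrI (S 0)); have := S_lin 1 0 0; rewrite scaler0 !addr0 scale1r.
have T0 : T 0 = 0.
  by apply: (addrI (T 0)); have := T_lin 1 0 0; rewrite scaler0 !addr0 scale1r.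
have SZ r x : S (r *: x) = r *: S x by rewrite -[r *: x]addr0 S_lin S0 addr0.
have TZ r x : T (r *: x) = r *: T x by rewrite -[r *: x]addr0 T_lin T0 addr0.
(* Both skew parts are multiples of the same area form; nondegeneracy turns this into
   proportionality. So either [S] is scalar or [T] is a combination of [S] and the identity. *)
have eqST x : x \in m -> wT *: (S x - a *: x) = wS *: (T x - b *: x).
  move=> xm; apply/eqP; rewrite -subr_eq0; apply/eqP; apply: nd.
    by rewrite !(memvB, memvZ) ?Sm ?Tm.
  move=> y ym; have [x1 [x2 xE]] := em x xm; have [y1 [y2 yE]] := em y ym.
  rewrite metricDl metricNl !metricZl xE yE (area S a) // (area T b) //.
  by rewrite -/wS -/wT; ring.
move=> x xm; case: (eqVneq wS 0) => wS0.
  have Sx y : y \in m -> S y = a *: y.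
    move=> ym; apply/eqP; rewrite -subr_eq0; apply/eqP; apply: nd.
      by rewrite memvB ?memvZ ?Sm.
    move=> z zm; have [y1 [y2 ->]] := em y ym; have [z1 [z2 ->]] := em z zm.
    by rewrite (area S a) // -/wS wS0 mulr0.
  by rewrite !Sx ?Tm // TZ.
have Tx y : y \in m -> T y = (wT / wS) *: S y + (b - wT / wS * a) *: y.
  move=> ym; have := eqST y ym => /(congr1 (fun z => wS^-1 *: z)).
  rewrite !scalerA mulVf // scale1r => /eqP; rewrite eq_sym subr_eq => /eqP ->.
  by rewrite mulrC scalerBr scalerA scalerBl -!addrA [- _ + _]addrC.
by rewrite !Tx ?Sm // S_lin SZ.
Qed.

End Metric.

(** * From conformality of the foliation to the action of [K] on [m] *)

Lemma conformal_foliation_ad (R : realType) (V : vectType R)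
    (br : V -> V -> V) (g : V -> V -> R) (nabla : V -> V -> V)
    (K m : {vspace V}) :
  is_lie_bracket br -> is_metric g -> levi_civita br g nabla ->
  (forall x y, x \in K -> y \in m -> g x y = 0) ->
  conformal_foliation g nabla K m ->
  exists lam : V -> R, forall A E F, A \in K -> E \in m -> F \in m ->
    g (br A E) F + g E (br A F) = 2 * lam A * g E F.
Proof.
move=> br_lie gm [tors comp] orth [V0 V0K conf].
(* The conformality equation is paired with [A]. Metric compatibility moves the derivatives onto
   [A], zero torsion swaps them for [nabla A] and brackets, and the [nabla A] terms cancel. *)
exists (g V0) => A E F AK Em Fm; have [h hm hE] := conf E F Em Fm.
have nablaE X Y : nabla X Y = br X Y + nabla Y X by rewrite -tors subrK.
have := congr1 (g^~ A) hE => /=.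
rewrite !(metricZl gm, metricDl gm) [g h A](metricC gm) (orth A h) // addr0.
have := comp E F A; have := comp F E A; have := comp A E F.
rewrite (nablaE E A) (nablaE F A) !(metricDr gm) (br_anti br_lie E) (br_anti br_lie F).
rewrite !(metricNr gm) (metricC gm F (br A E)) (metricC gm F (nabla A E)).
by move=> c1 c2 c3 c4; lra.
Qed.

(* The conformal endomorphisms of the plane [m] commute and [K] is perfect, so
   [K] acts trivially on the quotient by [K], which is [m]. *)
Lemma conformal_semisimple_ideal (R : realType) (V : vectType R)
    (br : V -> V -> V) (g : V -> V -> R) (nabla : V -> V -> V)
    (K m : {vspace V}) :
  is_lie_bracket br -> is_metric g -> levi_civita br g nabla ->
  semisimple_lie br K -> (K + m)%VS = fullv -> (K :&: m = 0)%VS ->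
  (forall x y, x \in K -> y \in m -> g x y = 0) ->
  \dim m = 2%N ->
  (forall x, x \in m -> (forall y, y \in m -> g x y = 0) -> x = 0) ->
  conformal_foliation g nabla K m ->
  forall A E, A \in K -> E \in m -> br A E \in K.
Proof.
move=> br_lie gm lc K_ss full cap0 orth dm nd conf A E AK Em.
have [lam lamP] := conformal_foliation_ad br_lie gm lc orth conf.
have mcap : (m :&: K = 0)%VS by rewrite capvC.
pose pm := daddv_pi m K; pose pk := daddv_pi K m.
have dec v : pk v + pm v = v by rewrite daddv_pi_add // full memvf.
have pkK v : pk v \in K by exact: memv_pi.
have pmm v : pm v \in m by exact: memv_pi.
have pmK v : v \in K -> pm v = 0.
  by move=> vK; apply: (addrI (pk v)); rewrite dec addr0 [pk v]daddv_pi_id.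
pose D B x := pm (br B x).
have D_lin B r x y : D B (r *: x + y) = r *: D B x + D B y.
  by rewrite /D (brPr br_lie) linearP.
have D_conf B x y : B \in K -> x \in m -> y \in m ->
    g (D B x) y + g x (D B y) = 2 * lam B * g x y.
  move=> BK xm ym; rewrite -(lamP B x y) // -(dec (br B x)) -(dec (br B y)).
  rewrite (metricDl gm) (metricDr gm) (orth (pk _) y) // (metricC gm x (pk _)) (orth (pk _) x) //.
  by rewrite !add0r.
have Dbr B C x : B \in K -> C \in K -> D (br B C) x = D B (D C x) - D C (D B x).
  (* The [K]-component dropped between the two brackets would remain in [K] under ad B', so the
     projection loses nothing. *)
  move=> BK CK; have DD B' C' : B' \in K -> pm (br B' (br C' x)) = D B' (D C' x).
    move=> BK'; rewrite -{1}(dec (br C' x)) (brDr br_lie) linearD /=.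
    by rewrite pmK ?add0r //; apply: K_ss.1.
  rewrite -!DD // -linearB /=; congr (pm _).
  by rewrite (br_jacobi br_lie B) addrK.
suff D0 : D A E = 0 by rewrite -(dec (br A E)) [pm _]D0 addr0.
move: AK; rewrite -{1}(semisimple_perfect br_lie K_ss).
move: A; apply: bracket_space_ind => [|a x y hx hy|B C BK CK].
- by rewrite /D (br0l br_lie) linear0.
- have -> : D (a *: x + y) E = a *: D x E + D y E by rewrite /D (brPl br_lie) linearP.
  by rewrite hx hy scaler0 addr0.
rewrite Dbr //; apply/eqP; rewrite subr_eq0; apply/eqP.
have Dm B' x : D B' x \in m by apply: pmm.
by apply: (@plane_conformal_commute _ _ _ gm m (D B) (D C) (lam B) (lam C)) => // x y;
  apply: D_conf.
Qed.

(** * The mixed vertical components of [k_l, m] *)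

Theorem theorem6p2 (R : realType) (V : vectType R)
    (br : V -> V -> V) (g : V -> V -> R) (nabla : V -> V -> V)
    (n : nat) (k : 'I_n -> {vspace V}) (m : {vspace V}) :
  is_lie_bracket br ->
  is_metric g ->
  levi_civita br g nabla ->
  (* K = K_1 x ... x K_n : each k_j a subalgebra, commuting pairwise,
     and k = k_1 + ... + k_n semisimple *)
  (forall j, subalgebra br (k j)) ->
  (forall i j x y, i != j -> x \in k i -> y \in k j -> br x y = 0) ->
  semisimple_lie br (\sum_i k i) ->
  (* orthogonal direct decomposition g = k_1 (+) ... (+) k_n (+) m *)
  (\sum_i k i + m)%VS = fullv ->
  (forall (c : 'I_n -> V) (cm : V), (forall i, c i \in k i) -> cm \in m ->
     \sum_i c i + cm = 0 -> (forall i, c i = 0) /\ cm = 0) ->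
  (forall i j x y, i != j -> x \in k i -> y \in k j -> g x y = 0) ->
  (forall i x y, x \in k i -> y \in m -> g x y = 0) ->
  (* m is two-dimensional and non-degenerate *)
  \dim m = 2%N ->
  (forall x, x \in m -> (forall y, y \in m -> g x y = 0) -> x = 0) ->
  (* the foliation generated by K is conformal *)
  conformal_foliation g nabla (\sum_i k i) m ->
  (* conclusion: V_j [V_k, H] = 0 for j <> k *)
  forall (j l : 'I_n), j != l ->
  forall E F, E \in k l -> F \in m ->
  forall (c : 'I_n -> V) (cm : V), (forall i, c i \in k i) -> cm \in m ->
    br E F = \sum_i c i + cm -> c j = 0.
Proof.
move=> br_lie gm lc k_sub k_com k_ss full direct _ orth dm nd conf.
move=> j l jl E F El Fm c cm ck cmm EF.
pose K := (\sum_i k i)%VS.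
have kK i x : x \in k i -> x \in K by move=> xi; apply: (subvP (sumv_sup i _ (subvv _))).
have cap0 : (K :&: m = 0)%VS.
  apply/eqP; rewrite -subv0; apply/subvP => x; rewrite memv_cap memv0.
  move=> /andP[/memv_sumP[d dk xE] xm].
  have [||_ /eqP] := direct d (- x) (fun i => dk i isT).
  - by rewrite rpredN.
  - by rewrite xE subrr.
  by rewrite oppr_eq0.
have orthK x y : x \in K -> y \in m -> g x y = 0.
  move=> /memv_sumP[d dk ->] ym; rewrite (metric_suml gm) big1 // => i _.
  by rewrite (orth i) ?dk.
have ideal A B := conformal_semisimple_ideal br_lie gm lc k_ss full cap0 orthK dm nd conf
  (A := A) (E := B).
have cm0 : cm = 0.
  apply/eqP; rewrite -memv0 -cap0 memv_cap cmm andbT.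
  have -> : cm = br E F - \sum_i c i by rewrite EF addrC addKr.
  apply: memvB; first by apply: ideal => //; apply: kK El.
  by apply: memv_suml => i _; apply: kK (ck i).
have disj x : x \in k j -> x \in k l -> x = 0.
  (* Directness is tested on the family with [x] in slot [j] and [- x] in slot [l], whose sum is
     zero. *)
  move=> xj xl; pose d i := if i == j then x else if i == l then - x else 0.
  have [i|||/(_ j) + _] := direct d 0; last by rewrite /d eqxx.
  - rewrite /d; case: eqP => [-> //|_]; case: eqP => [->|_]; last exact: mem0v.
    by rewrite rpredN.
  - exact: mem0v.
  rewrite addr0 (bigD1 j) //= (bigD1 l) 1?eq_sym //= {1 2}/d eqxx.
  rewrite eq_sym (negPf jl) eqxx addrA subrr add0r big1 // => i.
  by rewrite /d => /andP[/negPf -> /negPf ->].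
have com A i : A \in K -> br A (c i) \in k i.
  move=> /memv_sumP[d dk ->]; rewrite (br_suml br_lie) memv_suml // => i' _.
  case: (eqVneq i' i) => [->|ii]; first by apply: k_sub; rewrite ?dk.
  by rewrite (k_com _ _ _ _ ii) ?dk // mem0v.
apply: (semisimple_center br_lie k_ss (kK _ _ (ck j))) => y /memv_sumP[d dk ->].
rewrite (br_suml br_lie) big1 // => i _.
case: (eqVneq i j) => [->|ij]; last by rewrite (k_com _ _ _ _ ij) ?dk.
have dj := dk j isT; apply: disj; first exact: k_sub.
(* The other components of [E, F] commute with k_j. By Jacobi and [d_j, E] = 0 the bracket becomes
   [E, [d_j, F]]; as [d_j, F] is in [K], only its k_l-component contributes, so the result lies in
   k_l. *)
have -> : br (d j) (c j) = br (d j) (br E F).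
  rewrite EF cm0 addr0 (br_sumr br_lie) (bigD1 j) //= big1 ?addr0 // => i' ij'.
  by rewrite (k_com j i') // eq_sym.
rewrite (br_jacobi br_lie) (k_com j l (d j) E jl) // (br0l br_lie) add0r.
have /memv_sumP[b bk ->] := ideal _ _ (kK _ _ dj) Fm.
rewrite (br_sumr br_lie) memv_suml // => i' _.
case: (eqVneq i' l) => [il|il]; first by apply: k_sub => //; rewrite -il bk.
by rewrite (k_com l i') ?mem0v // ?bk // eq_sym.
Qed.
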